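(* Let $\{x_t\}$ be generated by the auto-conditioned projected gradient (AC-PG) method described in the context, with $x_0\in X$ and $0<L_0\le L$. Then $$\min_{t\in\{1,\dots,k\}}\|g_{X,t}\|^2\le\frac{48\,\hat L_{k-1}^2D_X^2}{(k-2m)^2}+\frac{12\,\hat L_{k-1}D_X^2\cdot\big(\sum_{t=0}^{k-1}\max\{0,l_t\}\big)}{(k-2m)^2},$$ where $\hat L_t=\max\{L_0,\dots,L_t\}$ and $m$, the number of segments of $\{x_0,\dots,x_k\}$ (defined in the context), satisfies $m\le\lfloor\log_{3/2}\tfrac{L}{L_0}\rfloor+1$.
   Context: $\|\cdot\|$ and $\langle\cdot,\cdot\rangle$ are Euclidean; the convention $\tfrac00=0$ is used. $X\subseteq\mathbb R^n$ is a convex compact set with diameter $D_X=\max_{x,y\in X}\|x-y\|$; $f:X\to\mathbb R$ is continuously differentiable with $\|\nabla f(x)-\nabla f(y)\|\le L\|x-y\|$ for all $x,y\in X$ (hence $f(x)-f(y)-\langle\nabla f(y),x-y\rangle\le\tfrac L2\|x-y\|^2$), and, for some $l\in[0,L]$, $f(x)-f(y)-\langle\nabla f(y),x-y\rangle\ge-\tfrac l2\|x-y\|^2$ for all $x,y\in X$. $x^*$ is a minimizer of $f$ over $X$. AC-PG method: for $t=1,2,\dots$, $x_t=\arg\min_{x\in X}\{\langle\nabla f(x_{t-1}),x\rangle+\tfrac{\gamma_t}{2}\|x_{t-1}-x\|^2\}$, where $\gamma_t=\hat L_{t-1}:=\max\{L_0,\dots,L_{t-1}\}$ and $L_t=\frac{2(f(x_t)-f(x_{t-1})-\langle\nabla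 f(x_{t-1}),x_t-x_{t-1}\rangle)}{\|x_t-x_{t-1}\|^2}$. Projected gradient: $g_{X,t}:=\gamma_{t+1}(x_t-x_{t+1})$. Segments: $x_0,x_1$ belong to the first segment, and for $t\ge2$ a new segment is started at $x_t$ whenever $L_t>\tfrac32\hat L_{t-1}$. Thus $m=1+\#\{2\le t\le k: L_t>\tfrac32\hat L_{t-1}\}$. Local lower curvature: $l_t:=\frac{2(f(x_t)+\langle\nabla f(x_t),x^*-x_t\rangle-f(x^* ))}{\|x_t-x^*\|^2}$ (so $l_t\le l$).
   Formalization: The displayed bound is proved for k > 2m only: at k = 2m the right-hand side is undefined, and for k < 2m it can fail (X=[-1,1], f=x²/2, L=1, L_0=0.01, x_0=1, k=1 gives 1 against 0.0192). The bound on m is proved for all k ≥ 1. *)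

(* Defs.v *)
From HB Require Import structures.
From mathcomp Require Import all_boot all_order all_algebra.
From mathcomp Require Import all_classical all_reals all_analysis.

Set Implicit Arguments.
Unset Strict Implicit.
Unset Printing Implicit Defensive.

Import Order.TTheory GRing.Theory Num.Theory.
Import numFieldNormedType.Exports.

Local Open Scope classical_set_scope.
Local Open Scope ring_scope.

Section Euclidean.
Variables (R : realType) (n : nat).
Implicit Types (u v x y g : 'rV[R]_n) (X : set 'rV[R]_n).

Definition dot u v : R := \sum_(i < n) u 0 i * v 0 i.

(* The library norm on matrices is the sup norm; it induces the same topology
   as this one, so the library's [compact] and [nbhs] can be used with it. *)
Definition enorm u : R := Num.sqrt (dot u u).

(* A maximum whenever [X] is compact and nonempty. *)
Definition diameter X : R :=
  sup [set enorm (p.1 - p.2) | p in X `*` X].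

(* Differentiability relative to [X]: [y] may lie on the boundary of [X] and
   [X] may have empty interior.  The quotient is [0] at [x = y]. *)
Definition is_gradient_within X (f : 'rV[R]_n -> R) y g : Prop :=
  (f x - f y - dot g (x - y)) / enorm (x - y) @[x --> within X (nbhs y)]
    --> (0 : R).

Definition continuously_differentiable_on X (f : 'rV[R]_n -> R)
    (gradf : 'rV[R]_n -> 'rV[R]_n) : Prop :=
  (forall y, X y -> is_gradient_within X f y (gradf y)) /\
  {within X, continuous gradf}.

Definition is_minimizer X (h : 'rV[R]_n -> R) x : Prop :=
  X x /\ forall y, X y -> h x <= h y.

End Euclidean.

Section ACPG.
Variables (R : realType) (n : nat).
Variables (X : set 'rV[R]_n) (f : 'rV[R]_n -> R).
Variables (gradf : 'rV[R]_n -> 'rV[R]_n) (L0 : R) (x : nat -> 'rV[R]_n).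

(* Division by zero yields [0], which agrees with the convention 0/0 = 0 since
   the numerator vanishes too when two successive iterates coincide. *)
Definition Lest (t : nat) : R :=
  if t is s.+1 then
    2 * (f (x s.+1) - f (x s) - dot (gradf (x s)) (x s.+1 - x s))
      / enorm (x s.+1 - x s) ^+ 2
  else L0.

(* The maximum of [Lest 0], ..., [Lest t]; the neutral element [L0] is
   [Lest 0]. *)
Definition hatL (t : nat) : R := \big[Num.max/L0]_(s < t.+1) Lest s.

(* Meaningful for [0 < t]. *)
Definition gamma (t : nat) : R := hatL t.-1.

Definition is_ACPG : Prop :=
  forall t, (0 < t)%N ->
    is_minimizer X
      (fun y => dot (gradf (x t.-1)) y
                + gamma t / 2 * enorm (x t.-1 - y) ^+ 2)
      (x t).

Definition proj_grad (t : nat) : 'rV[R]_n := gamma t.+1 *: (x t - x t.+1).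

Definition starts_segment (t : nat) : bool := 3 / 2 * hatL t.-1 < Lest t.

(* The number of segments of x_0, ..., x_k. *)
Definition nsegments (k : nat) : nat :=
  (1 + count starts_segment (index_iota 2 k.+1))%N.

(* Same remark on 0/0 as for [Lest]. *)
Definition local_curvature (xstar : 'rV[R]_n) (t : nat) : R :=
  2 * (f (x t) + dot (gradf (x t)) (xstar - x t) - f xstar)
    / enorm (x t - xstar) ^+ 2.

End ACPG.

(* Main.v *)
Require Import Defs.
From HB Require Import structures.
From mathcomp Require Import all_boot all_order all_algebra.
From mathcomp Require Import all_classical all_reals all_analysis.
From mathcomp Require Import ring lra zify.

Set Implicit Arguments.
Unset Strict Implicit.
Unset Printing Implicit Defensive.

Import Order.TTheory GRing.Theory Num.Theory.
Import numFieldNormedType.Exports.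

Local Open Scope classical_set_scope.
Local Open Scope ring_scope.

(** The method is compared with the minimizer [xstar] through three sequences:
the gap [f (x t) - f xstar], the squared distance [enorm (x t - xstar) ^+ 2]
and the squared step length.  Write H for [hatL].  The strongly convex
subproblem solved at each step, tested against [x t] and against [xstar],
yields [ACPG_descent] and [ACPG_gap].  When step t+1 does not start a segment,
its curvature estimate is at most 3/2 H t, hence it decreases f by at least
q = (H t / 4) ||x_t - x_(t+1)||^2 = ||g_t||^2 / (4 H t), while the gap after the
step is at most q plus a difference of squared distances, scaled by H t / 2,
plus half the positive part of the local curvature times D^2.

Inside one segment the two inequalities are combined by a weighted potential
([segment_potential]): after n good steps the gap carries weight n + 1, each
further step trades the weight against q, and the weights add up to
n (n - 1) / 2.  The step which opens the segment is used in the gap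
inequality too; it costs only Gam - H u, where Gam is the largest estimate of
the segment and H u the largest one before it.  The outcome is
(n - 1)^2 G <= Gam (8 Gam - 4 H u + 4 S) D^2 ([segment_bound]), where G is the
smallest squared projected gradient and S the sum of the positive local
curvatures over the steps of the segment.

Taking square roots, the lengths n - 1 can be added over the segments by the
Cauchy-Schwarz inequality: (sum of (n_i - 1))^2 G is bounded by the product of
sum Gam_i and sum (8 Gam_i - 4 Gam_(i-1) + 4 S_i), up to D^2.  Each segment
multiplies the largest estimate by more than 3/2, so the first sum is at most
3 Gam and the second one at most 16 Gam + 4 S for the last Gam.  This is where
48 = 3 * 16 and 12 = 3 * 4 come from.  A segment with n good steps has n + 1
points and the first one has the additional point x_0, so that the lengths
n_i - 1 sum to at least k - 2 m.

The same geometric growth bounds the number of segments, once every estimate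
is known to be at most L.  This is the usual quadratic upper bound for a
function with L-Lipschitz gradient ([linerr_upper]); instead of integrating
the gradient along a segment, a crude bound obtained from the lower curvature
is improved by bisecting the segment repeatedly. *)

(** * Adding up bounds over segments *)

Lemma index_iota_rcons m n : (m <= n)%N ->
  index_iota m n.+1 = rcons (index_iota m n) n.
Proof.
by move=> mn; rewrite /index_iota subSn // -addn1 iotaD -cats1 subnKC.
Qed.

(** The Cauchy-Schwarz inequality for two terms, for quantities [P] and [p] that
are known only through the bounds sqrt (A B / G) and sqrt (a b / G). *)
Lemma cauchy_schwarz2 (R : realFieldType) (P p G A B a b : R) :
  0 <= P -> 0 <= p -> 0 <= G -> 0 <= A -> 0 <= B -> 0 <= a -> 0 <= b ->
  P ^+ 2 * G <= A * B -> p ^+ 2 * G <= a * b ->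
  (P + p) ^+ 2 * G <= (A + a) * (B + b).
Proof.
move=> P0 p0 G0 A0 B0 a0 b0 hP hp.
have cross : 2 * P * p * G <= A * b + a * B.
  have hsq : (2 * P * p * G) ^+ 2 <= (A * b + a * B) ^+ 2.
    have hm : (P ^+ 2 * G) * (p ^+ 2 * G) <= (A * B) * (a * b).
      by apply: ler_pM => //; rewrite mulr_ge0 ?sqr_ge0.
    have := sqr_ge0 (A * b - a * B); nra.
  by rewrite -(@ler_pXn2r _ 2%N) // nnegrE ?addr_ge0 ?mulr_ge0.
by nra.
Qed.

Section Segments.
(** The scalar shadow of a run: [Delta] is the optimality gap, [a] the squared
distance to the minimizer, [d t] the squared length of the step from t to t+1,
[H] the running maximum of the curvature estimates [Le], [curv] the positive
part of the local lower curvature, [D2] the squared diameter and [G] a lower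
bound for the squared projected gradients. *)
Variables (R : realFieldType) (Delta a d H Le curv : nat -> R) (D2 G : R).
Hypotheses (D2_ge0 : 0 <= D2) (G_ge0 : 0 <= G).
Hypotheses (Delta_ge0 : forall t, 0 <= Delta t).
Hypotheses (a_rng : forall t, 0 <= a t <= D2) (d_rng : forall t, 0 <= d t <= D2).
Hypotheses (H_gt0 : forall t, 0 < H t) (H_le : forall t, H t <= H t.+1).
Hypotheses (Le_le_H : forall t, Le t <= H t) (curv_ge0 : forall t, 0 <= curv t).
Hypothesis descent :
  forall t, Delta t.+1 <= Delta t - H t * d t + Le t.+1 / 2 * d t.
Hypothesis gap : forall t,
  Delta t.+1 <= curv t / 2 * a t + H t / 2 * (a t - a t.+1)
                + (Le t.+1 - H t) / 2 * d t.

Let starts t := 3 / 2 * H t.-1 < Le t.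

Lemma H_homo s t : (s <= t)%N -> H s <= H t.
Proof.
move: s t; apply: (homo_leq (r := fun y z => y <= z)) => [u|y u v|] //.
exact: le_trans.
Qed.

(** Here u is the step that opens the segment, of arbitrary curvature, and it is
followed by n good steps.  Going from n to n + 1, the weight n + 1 of the gap is
multiplied by the descent inequality, which releases n + 1 times q, and one more
copy of the gap is added by the gap inequality, which costs one q; the n copies
that remain turn n (n - 1) / 2 into (n + 1) n / 2.  As H is nondecreasing, the
differences of squared distances telescope to at most H (D2 - a) / 2. *)
Lemma segment_potential (Gam : R) (u n : nat) :
  Le u.+1 <= Gam -> H (u + n)%N <= Gam ->
  (forall t, (u.+1 < t <= u + n.+1)%N -> ~~ starts t) ->
  (forall t, (u < t <= u + n)%N -> G <= H t ^+ 2 * d t) ->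
  n.+1%:R * Delta (u + n.+1)%N + n%:R * (n%:R - 1) / 2 * (G / (4 * Gam)) <=
    (Gam - H u) / 2 * D2 + H (u + n)%N / 2 * (D2 - a (u + n.+1)%N)
    + (\sum_(u <= t < u + n.+1) curv t) / 2 * D2.
Proof.
move=> hLe; elim: n => [|n IH] hH hgood hG.
  rewrite addn0 in hH; rewrite addn0 addn1 big_nat1.
  have := gap u; have /andP[a0 aD] := a_rng u; have /andP[d0 dD] := d_rng u.
  have l0 := curv_ge0 u.
  have h1 : (Le u.+1 - H u) / 2 * d u <= (Gam - H u) / 2 * D2.
    apply: (@le_trans _ _ ((Gam - H u) / 2 * d u)).
      by rewrite ler_wpM2r // ler_wpM2r // lerD2r.
    by rewrite ler_wpM2l // mulr_ge0 // subr_ge0.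
  have h2 : curv u / 2 * a u <= curv u / 2 * D2 by rewrite ler_wpM2l // mulr_ge0.
  have h3 : H u / 2 * (a u - a u.+1) <= H u / 2 * (D2 - a u.+1).
    by rewrite ler_wpM2l ?lerD2r // mulr_ge0 // ltW.
  rewrite mul0r !mul0r addr0 mul1r; lra.
have hHn : H (u + n)%N <= H (u + n.+1)%N by rewrite addnS; apply: H_le.
have {}IH := IH (le_trans hHn hH)
  (fun t ht => hgood t ltac:(lia)) (fun t ht => hG t ltac:(lia)).
have good : Le (u + n.+2)%N <= 3 / 2 * H (u + n.+1)%N.
  by rewrite leNgt; have := hgood (u + n.+2)%N ltac:(lia); rewrite /starts addnS.
have hGe := hG (u + n.+1)%N ltac:(lia).
move: (descent (u + n.+1)%N) (gap (u + n.+1)%N); rewrite -addnS.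
have -> : \sum_(u <= t < u + n.+2) curv t
    = \sum_(u <= t < u + n.+1) curv t + curv (u + n.+1)%N.
  by rewrite addnS big_nat_recr ?leq_addr.
have /andP[a0 aD] := a_rng (u + n.+1)%N.
have /andP[d0 dD] := d_rng (u + n.+1)%N.
have l0 := curv_ge0 (u + n.+1)%N; have H0 := H_gt0 (u + n.+1)%N.
move: IH hHn hH good hGe d0 l0 H0 a0 aD.
set e := (u + n.+1)%N; set e' := (u + n.+2)%N; set S := \sum_(u <= t < e) _.
move: (H e) (H (u + n)%N) (Le e') (d e) (curv e) (a e) (a e') (Delta e) (Delta e').
move=> He Hn Lee de le ae ae' De De' IH hHn hH good hGe d0 l0 H0 a0 aD hdesc hgap.
have Gam0 : 0 < Gam by apply: lt_le_trans hH.
have hLd : Lee * de <= 3 / 2 * He * de by rewrite ler_wpM2r.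
have hla : le * ae <= le * D2 by rewrite ler_wpM2l.
have hHD : Hn * (D2 - ae) <= He * (D2 - ae) by rewrite ler_wpM2r // subr_ge0.
have n0 : 0 <= n%:R :> R by [].
(* A good step decreases the gap by H d - (3 / 4) H d. *)
have hdn : n.+1%:R * De' <= n.+1%:R * (De - He * de / 4).
  by rewrite ler_wpM2l //; clear IH hHD hla; lra.
have hq : G / (4 * Gam) <= He * de / 4.
  rewrite ler_pdivrMr ?mulr_gt0 //.
  apply: le_trans hGe _; rewrite expr2.
  have : He * (He * de) <= Gam * (He * de).
    by rewrite ler_wpM2r // mulr_ge0 // ltW.
  by clear IH hHD hla; lra.
move: IH hq; move: (G / (4 * Gam)) => q IH hq.
have hqn : n%:R * q <= n%:R * (He * de / 4) by rewrite ler_wpM2l.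
move: IH hdn; rewrite -[n.+2%:R]natr1 -[n.+1%:R]natr1 => IH hdn.
clear hGe hq hdesc; lra.
Qed.

(** The factor n (n - 1) of the potential is weakened to (n - 1)^2 because the
bounds for the segments are going to be added after taking square roots; the
predecessor makes a segment without good steps count for 0 instead of 1. *)
Lemma segment_bound (Gam : R) (u n : nat) :
  Le u.+1 <= Gam -> H (u + n)%N <= Gam ->
  (forall t, (u.+1 < t <= u + n.+1)%N -> ~~ starts t) ->
  (forall t, (u < t <= u + n)%N -> G <= H t ^+ 2 * d t) ->
  n.-1%:R ^+ 2 * G <=
    Gam * ((8 * Gam - 4 * H u + 4 * \sum_(u <= t < u + n.+1) curv t) * D2).
Proof.
move=> hLe hH hgood hG; have := segment_potential hLe hH hgood hG.
have Gam0 : 0 < Gam by apply: lt_le_trans hH.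
have HuG : H u <= Gam by apply: le_trans hH; apply: H_homo; apply: leq_addr.
set S := \sum_(u <= t < _) curv t.
have S0 : 0 <= S by apply: sumr_ge0.
have /andP[a0 aD] := a_rng (u + n.+1)%N.
have hn : n.-1%:R ^+ 2 <= n%:R * (n%:R - 1) :> R.
  case: n {hH hgood hG S S0 a0 aD} => [|n] /=; first by rewrite expr0n mul0r.
  by rewrite -natr1 addrK expr2 ler_wpM2r // lerDl.
move=> hpot.
have h1 : n%:R * (n%:R - 1) / 2 * (G / (4 * Gam)) <=
    (Gam - H u) / 2 * D2 + Gam / 2 * D2 + S / 2 * D2.
  have : 0 <= n.+1%:R * Delta (u + n.+1)%N by rewrite mulr_ge0.
  have : H (u + n)%N / 2 * (D2 - a (u + n.+1)%N) <= Gam / 2 * D2.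
    have := H_gt0 (u + n)%N.
    by move=> /ltW Hn0; apply: ler_pM; rewrite ?divr_ge0 ?subr_ge0 //; lra.
  lra.
apply: (@le_trans _ _ (n%:R * (n%:R - 1) * G)); first by rewrite ler_wpM2r.
rewrite (_ : n%:R * (n%:R - 1) * G =
  8 * Gam * (n%:R * (n%:R - 1) / 2 * (G / (4 * Gam)))); last first.
  by field; rewrite lt0r_neq0.
have : 8 * Gam * (n%:R * (n%:R - 1) / 2 * (G / (4 * Gam))) <=
  8 * Gam * ((Gam - H u) / 2 * D2 + Gam / 2 * D2 + S / 2 * D2).
  by rewrite ler_wpM2l // mulr_ge0 // ltW.
move=> /le_trans; apply; lra.
Qed.

(** [P] stands for the sum of n - 1 over the segments before the step u.  Both
factors 3 H u and 16 H u + 4 S reproduce themselves when H u <= (2 / 3) Gam: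
3 H u + Gam <= 3 Gam and (16 H u) + (8 Gam - 4 H u) <= 16 Gam.  The opening step
of the first segment need not make H grow, but there [P] is still 0. *)
Lemma append_segment (Gam P : R) (u n : nat) :
  Le u.+1 <= Gam -> H (u + n)%N <= Gam ->
  (forall t, (u.+1 < t <= u + n.+1)%N -> ~~ starts t) ->
  (forall t, (u < t <= u + n)%N -> G <= H t ^+ 2 * d t) ->
  0 <= P -> (P == 0) || starts u.+1 ->
  P ^+ 2 * G <= 3 * H u * ((16 * H u + 4 * \sum_(0 <= t < u) curv t) * D2) ->
  (P + n.-1%:R) ^+ 2 * G <=
    3 * Gam * ((16 * Gam + 4 * \sum_(0 <= t < u + n.+1) curv t) * D2).
Proof.
move=> hLe hH hgood hG P0 hstart hP; have hp := segment_bound hLe hH hgood hG.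
have Gam0 : 0 < Gam by apply: lt_le_trans hH.
have HuG : H u <= Gam by apply: le_trans hH; apply: H_homo; apply: leq_addr.
rewrite (@big_cat_nat _ _ _ u) //=; last exact: leq_addr.
move: hP hp; set S := \sum_(0 <= t < u) _; set S' := \sum_(u <= t < _) _ => hP hp.
have S0 : 0 <= S by apply: sumr_ge0.
have S'0 : 0 <= S' by apply: sumr_ge0.
have H0 := H_gt0 u.
have b0 : 0 <= 8 * Gam - 4 * H u + 4 * S' by lra.
have [P_eq0|P_neq0] := eqVneq P 0.
  rewrite P_eq0 add0r; apply: le_trans hp _.
  apply: ler_pM; [exact: ltW | exact: mulr_ge0 | lra |].
  by apply: ler_wpM2r => //; lra.
have grow : 3 / 2 * H u <= Gam.
  by move: hstart; rewrite (negPf P_neq0) /= => /ltW /le_trans; apply.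
have B0 : 0 <= 16 * H u + 4 * S by lra.
have H3 : 0 <= 3 * H u by rewrite mulr_ge0 // ltW.
apply: le_trans (cauchy_schwarz2 P0 (ler0n R n.-1) G_ge0 H3
  (mulr_ge0 B0 D2_ge0) (ltW Gam0) (mulr_ge0 b0 D2_ge0) hP hp) _.
apply: ler_pM; [by lra | by rewrite addr_ge0 ?mulr_ge0 | by lra |].
by rewrite -mulrDl ler_wpM2r //; lra.
Qed.

(** At every index j the run is described by the opening step u of the current
segment and by the bound for the segments that are already complete.  Those
contain the points 1 to u, and each of them was ended by one of the counted
starts: this is the lower bound u - 2 c for [P]. *)
Lemma segments_bound (k : nat) :
  (forall t, (0 < t < k)%N -> G <= H t ^+ 2 * d t) ->
  forall j, (0 < j <= k)%N -> exists u P,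
    [/\ (u < j)%N, forall t, (u.+1 < t <= j)%N -> ~~ starts t,
      0 <= P, (P == 0) || starts u.+1 &
      u%:R - 2 * (count starts (index_iota 2 j.+1))%:R <= P /\
      P ^+ 2 * G <= 3 * H u * ((16 * H u + 4 * \sum_(0 <= t < u) curv t) * D2)].
Proof.
move=> hG; elim=> // -[_|j IH] hj.
  exists 0%N, 0; split=> //; first by case=> [|[|t]].
  by rewrite eqxx.
  split; first by rewrite /index_iota /= mulr0 subr0.
  rewrite expr0n mul0r big_nil mulr0 addr0 !mulr_ge0 //; exact: ltW.
have [//|u [P [uj hgood P0 hs [hPc hP]]]] := IH _; first by lia.
rewrite (@index_iota_rcons 2 j.+2) // -cats1 count_cat /= addn0.
have [sj|nsj] := boolP (starts j.+2); last first.
  exists u, P; split=> //; first by lia.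
    move=> t ht; have [->//|tj] := eqVneq t j.+2.
    by apply: hgood; lia.
  by rewrite addn0.
have uE : (u + (j - u).+1 = j.+1)%N by lia.
have uE' : (u + (j - u) = j)%N by lia.
exists j.+1, (P + (j - u).-1%:R); split=> //.
- by move=> t; lia.
- by rewrite addr_ge0.
- by rewrite sj orbT.
split.
  rewrite natrD mulrDr mulr1.
  have : j.+1%:R <= u%:R + (j - u).-1%:R + 2 :> R by rewrite -!natrD ler_nat; lia.
  lra.
rewrite -[X in \sum_(0 <= t < X) _]uE.
apply: append_segment => //.
- by apply: le_trans (Le_le_H _) _; apply: H_homo; lia.
- by rewrite uE'.
- by rewrite uE.
- by rewrite uE' => t ht; apply: hG; lia.
Qed.

Lemma all_segments_bound (k : nat) :
  let m := (1 + count starts (index_iota 2 k.+1))%N in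
  (2 * m < k)%N ->
  (forall t, (0 < t < k)%N -> G <= H t ^+ 2 * d t) ->
  (k%:R - 2 * m%:R) ^+ 2 * G <=
    3 * H k.-1 * ((16 * H k.-1 + 4 * \sum_(0 <= t < k) curv t) * D2).
Proof.
move=> m mk hG.
have [|u [P [uk hgood P0 hs [hPc hP]]]] := segments_bound hG (j := k); first by lia.
have km : 0 <= k%:R - 2 * m%:R :> R by rewrite subr_ge0 -natrM ler_nat ltnW.
have mE : m%:R = 1 + (count starts (index_iota 2 k.+1))%:R :> R by rewrite natrD.
suff [Q [Q0 hQ hQG]] : exists Q, [/\ 0 <= Q, k%:R - 2 * m%:R <= Q &
    Q ^+ 2 * G <= 3 * H k.-1 * ((16 * H k.-1 + 4 * \sum_(0 <= t < k) curv t) * D2)].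
  apply: le_trans hQG; rewrite ler_wpM2r // ler_pXn2r // nnegrE //.
(* A segment that starts at the last point k has no good step, and its estimate
   [Le k] may exceed [H k.-1]: it is left out. *)
have [uE|uk1] := eqVneq u k.-1.
  exists P; split=> //.
    have kE : k%:R = u%:R + 1 :> R by rewrite natr1 uE prednK //; lia.
    by rewrite mE kE; lra.
  rewrite uE in hP; apply: le_trans hP _.
  apply: ler_wpM2l; first by rewrite mulr_ge0 // ltW.
  rewrite ler_wpM2r // lerD2l ler_wpM2l //.
  rewrite -[X in _ <= \sum_(0 <= t < X) _](@prednK k); last by lia.
  by rewrite big_nat_recr //= lerDl.
have uE : (u + (k - u).-1.+1 = k)%N by lia.
have uE' : (u + (k - u).-1 = k.-1)%N by lia.
exists (P + (k - u).-1.-1%:R); split.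
- by rewrite addr_ge0.
- have : k%:R <= u%:R + (k - u).-1.-1%:R + 2 :> R by rewrite -!natrD ler_nat; lia.
  by rewrite mE; lra.
rewrite -[X in \sum_(0 <= t < X) _]uE.
apply: append_segment => //.
- by apply: le_trans (Le_le_H _) _; apply: H_homo; lia.
- by rewrite uE'.
- by rewrite uE.
- by rewrite uE' => t ht; apply: hG; lia.
Qed.

End Segments.

(** * Euclidean geometry *)

Section Dot.
Variables (R : realType) (n : nat).
Implicit Types (u v w : 'rV[R]_n) (c : R).

Lemma dotC u v : dot u v = dot v u.
Proof. by apply: eq_bigr => i _; rewrite mulrC. Qed.

Lemma dotDr u v w : dot u (v + w) = dot u v + dot u w.
Proof. by rewrite -big_split; apply: eq_bigr => i _; rewrite mxE mulrDr. Qed.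

Lemma dotZr c u v : dot u (c *: v) = c * dot u v.
Proof. by rewrite mulr_sumr; apply: eq_bigr => i _; rewrite mxE mulrCA. Qed.

Lemma dotNr u v : dot u (- v) = - dot u v.
Proof. by rewrite -scaleN1r dotZr mulN1r. Qed.

Lemma dotBr u v w : dot u (v - w) = dot u v - dot u w.
Proof. by rewrite dotDr dotNr. Qed.

Lemma dotBl u v w : dot (u - v) w = dot u w - dot v w.
Proof. by rewrite dotC dotBr !(dotC w). Qed.

Lemma dotZl c u v : dot (c *: u) v = c * dot u v.
Proof. by rewrite dotC dotZr dotC. Qed.

Lemma dot_ge0 u : 0 <= dot u u.
Proof. by apply: sumr_ge0 => i _; rewrite -expr2 sqr_ge0. Qed.

Lemma enorm_sq u : enorm u ^+ 2 = dot u u.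
Proof. by rewrite sqr_sqrtr // dot_ge0. Qed.

Lemma enorm_ge0 u : 0 <= enorm u.
Proof. exact: sqrtr_ge0. Qed.

Lemma enorm_eq0 u : enorm u = 0 -> u = 0.
Proof.
move=> /(congr1 (fun r => r ^+ 2)); rewrite enorm_sq expr0n /= => /eqP.
rewrite psumr_eq0 => [/allP h|i _]; last by rewrite -expr2 sqr_ge0.
apply/rowP => i; rewrite mxE; have := h i (mem_index_enum i).
by rewrite mulf_eq0 orbb => /eqP.
Qed.

Lemma enormZ c u : enorm (c *: u) = `|c| * enorm u.
Proof.
by rewrite /enorm dotZl dotZr mulrA -expr2 sqrtrM ?sqr_ge0 // sqrtr_sqr.
Qed.

Lemma enorm_subC u v : enorm (u - v) = enorm (v - u).
Proof. by rewrite -opprB -scaleN1r enormZ normrN1 mul1r. Qed.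

Lemma dot_le_enorm u v : dot u v <= enorm u * enorm v.
Proof.
have [u0|u_neq0] := eqVneq (enorm u) 0.
  rewrite u0 mul0r (enorm_eq0 u0).
  by rewrite /dot big1 // => i _; rewrite mxE mul0r.
have [v0|v_neq0] := eqVneq (enorm v) 0.
  rewrite v0 mulr0 (enorm_eq0 v0).
  by rewrite /dot big1 // => i _; rewrite mxE mulr0.
have uv_gt0 : 0 < enorm u * enorm v.
  by rewrite mulr_gt0 // lt_def ?u_neq0 ?v_neq0 enorm_ge0.
rewrite -subr_ge0 -(pmulr_rge0 _ uv_gt0).
have := dot_ge0 (enorm v *: u - enorm u *: v).
rewrite dotBl !dotBr !dotZl !dotZr -!enorm_sq (dotC v u); lra.
Qed.

Lemma enorm_sqB u v :
  enorm (u - v) ^+ 2 = enorm u ^+ 2 - 2 * dot u v + enorm v ^+ 2.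
Proof. by rewrite !enorm_sq dotBl !dotBr (dotC v u); ring. Qed.

End Dot.

(** * Projected steps and the quadratic upper bound *)

(** A quadratic that vanishes at 0 and is nonnegative to the right of 0 has a
nonnegative slope there. *)
Lemma linear_coef_ge0 (R : realFieldType) (A B : R) :
  (forall c, 0 < c <= 1 -> 0 <= c * A + c ^+ 2 * B) -> 0 <= A.
Proof.
move=> h; rewrite leNgt; apply/negP => A_lt0.
have h1 := h 1; rewrite ltr01 lexx expr1n !mul1r in h1; have {}h1 := h1 isT.
have B_gt0 : 0 < B by lra.
have c_gt0 : 0 < - A / (2 * B) by rewrite divr_gt0 ?mulr_gt0 // oppr_gt0.
have [c_le1|] := leP (- A / (2 * B)) 1; last first.
  by rewrite ltr_pdivlMr ?mulr_gt0 //; lra.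
have := h _ (introT andP (conj c_gt0 c_le1)).
rewrite expr2 -mulrA -mulrDr (pmulr_rge0 _ c_gt0).
have -> : - A / (2 * B) * B = - A / 2 by field; rewrite lt0r_neq0.
lra.
Qed.

Lemma le_of_halving (R : realType) (a b C : R) :
  (forall N, a <= b + C / 2 ^+ N) -> a <= b.
Proof.
move=> h; rewrite leNgt; apply/negP => ba.
have ab0 : 0 < a - b by rewrite subr_gt0.
have := truncnS_gt (C / (a - b)); set N := (Num.truncn _).+1 => hN.
have := h N; rewrite -lerBlDl ler_pdivlMr ?exprn_gt0 //.
apply/negP; rewrite -ltNge mulrC -ltr_pdivrMr //.
by apply: lt_trans hN _; rewrite -natrX ltr_nat ltn_expl.
Qed.

Section Domain.
Variables (R : realType) (n : nat) (X : set 'rV[R]_n).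
Implicit Types (y z w : 'rV[R]_n).

(** Compactness serves to bound the set of distances, so that its supremum is an
upper bound. *)
Lemma dist_le_diameter y z : compact X -> X y -> X z -> enorm (y - z) <= diameter X.
Proof.
move=> /compact_bounded [M [_ hM]] Xy Xz.
have hB v i : X v -> `|v 0 i| <= M + 1.
  move=> Xv; apply: le_trans (hM (M + 1) _ v Xv); last by rewrite ltrDl.
  rewrite [leRHS]/Num.norm /= mx_normrE.
  exact: (le_bigmax _ (fun ij => `|v ij.1 ij.2|) (0, i)).
apply: ub_le_sup; last by exists (y, z).
exists (Num.sqrt (\sum_(i < n) (2 * (M + 1)) ^+ 2)) => _ [[v w] /= [Xv Xw] <-].
rewrite ler_sqrt; last by apply: sumr_ge0 => i _; apply: sqr_ge0.
apply: ler_sum => i _; rewrite -expr2 !mxE -real_normK ?num_real //.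
rewrite ler_pXn2r ?nnegrE //; last first.
  by rewrite mulr_ge0 // (le_trans (normr_ge0 _) (hB v i Xv)).
apply: le_trans (ler_normB _ _) _.
by have := hB v i Xv; have := hB w i Xw; lra.
Qed.

Hypothesis X_convex : convex_set (X : set (convex_lmodType 'rV[R]_n)).

Lemma convex_segment y z c : X y -> X z -> 0 <= c <= 1 -> X (y + c *: (z - y)).
Proof.
move=> Xy Xz /andP[c0 c1].
have := X_convex (Itv01 c0 c1) (mem_set Xz) (mem_set Xy); move/set_mem.
congr X; rewrite /conv /= /unstable.onem scalerBl scale1r scalerBr addrC.
by rewrite -!addrA [- _ + _]addrC.
Qed.

(** The objective of the subproblem is [gam]-strongly convex, so that it exceeds
its minimum at [y] by at least gam / 2 times the squared distance from [p]. *)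
Lemma prox_three_points (g w p y : 'rV[R]_n) (gam : R) :
  is_minimizer X (fun v => dot g v + gam / 2 * enorm (w - v) ^+ 2) p -> X y ->
  dot g (p - y) + gam / 2 * enorm (w - p) ^+ 2 + gam / 2 * enorm (p - y) ^+ 2
    <= gam / 2 * enorm (w - y) ^+ 2.
Proof.
move=> [Xp p_min] Xy.
have slope : 0 <= dot g (y - p) - gam * dot (w - p) (y - p).
  apply: (@linear_coef_ge0 R _ (gam / 2 * enorm (y - p) ^+ 2)) => c /andP[c0 c1].
  have := p_min _ (convex_segment Xp Xy (introT andP (conj (ltW c0) c1))).
  rewrite opprD addrA (enorm_sqB (w - p)) dotDr !dotZr enormZ (gtr0_norm c0) exprMn.
  lra.
have -> : w - y = (w - p) - (y - p) by rewrite opprB addrA subrK.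
rewrite (enorm_sqB (w - p)) (enorm_subC p y) -(opprB y p) dotNr.
lra.
Qed.

Variables (f : 'rV[R]_n -> R) (gradf : 'rV[R]_n -> 'rV[R]_n) (L l : R).

(** Error at [y] of the linearization of [f] at [z]. *)
Let linerr y z := f y - f z - dot (gradf z) (y - z).

Hypothesis gradf_lip : forall y z, X y -> X z ->
  enorm (gradf y - gradf z) <= L * enorm (y - z).
Hypothesis f_lower : forall y z, X y -> X z ->
  - (l / 2) * enorm (y - z) ^+ 2 <= linerr y z.

Lemma gradf_dot_le y z w : X y -> X z ->
  dot (gradf y - gradf z) w <= L * enorm (y - z) * enorm w.
Proof.
move=> Xy Xz; apply: le_trans (dot_le_enorm _ _) _.
by rewrite ler_wpM2r ?enorm_ge0 // gradf_lip.
Qed.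

(** The lower curvature bound with [y] and [z] exchanged yields the constant
L / 2 + (L + l) / 2.  Applying a constant L / 2 + c to the two halves of the
segment, and the Lipschitz bound to the gradients at [z] and at the midpoint,
yields L / 4 + (L / 2 + c) / 2 = L / 2 + c / 2 for the whole segment. *)
Lemma linerr_bisect (N : nat) y z : X y -> X z ->
  linerr y z <= (L / 2 + (L + l) / 2 / 2 ^+ N) * enorm (y - z) ^+ 2.
Proof.
elim: N y z => [|N IH] y z Xy Xz.
  have := gradf_dot_le (y - z) Xy Xz; have := f_lower Xz Xy.
  rewrite /linerr dotBl (enorm_subC z y) -(opprB y z) dotNr expr0.
  by rewrite invr1 mulr1; lra.
have half : 0 <= (2^-1 : R) <= 1 by apply/andP; split; lra.
set w := z + 2^-1 *: (y - z).
have Xw : X w by apply: convex_segment.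
have wz : w - z = 2^-1 *: (y - z) by rewrite addrC addKr.
have yw : y - w = 2^-1 *: (y - z).
  by rewrite opprD addrA -[X in X - _ = _]scale1r -scalerBl; congr (_ *: _); lra.
have := IH _ _ Xy Xw; have := IH _ _ Xw Xz; have := gradf_dot_le (y - w) Xw Xz.
rewrite /linerr wz yw dotBl !dotZr !enormZ ger0_norm ?invr_ge0 //.
rewrite [2 ^+ N.+1]exprS invfM; set c := (L + l) / 2 / 2 ^+ N.
have -> : (L + l) / 2 * (2^-1 * (2 ^+ N)^-1) = c / 2 by rewrite /c; ring.
move: c => c; lra.
Qed.

Lemma linerr_upper y z : X y -> X z -> linerr y z <= L / 2 * enorm (y - z) ^+ 2.
Proof.
move=> Xy Xz; apply: (@le_of_halving R _ _ ((L + l) / 2 * enorm (y - z) ^+ 2)) => N.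
apply: le_trans (linerr_bisect N Xy Xz) _; rewrite mulrDl lerD2l.
by rewrite (mulrAC _ (2 ^+ N)^-1).
Qed.

End Domain.

(** * The iterates *)

Section Iterates.
Variables (R : realType) (n : nat) (X : set 'rV[R]_n) (f : 'rV[R]_n -> R).
Variables (gradf : 'rV[R]_n -> 'rV[R]_n) (L l L0 : R) (x : nat -> 'rV[R]_n).

Local Notation Lest := (Defs.Lest f gradf L0 x).
Local Notation hatL := (Defs.hatL f gradf L0 x).
Local Notation starts := (starts_segment f gradf L0 x).

Lemma Lest_le_hatL t : Lest t <= hatL t.
Proof. exact: (le_bigmax _ (fun s : 'I_t.+1 => Lest s) ord_max). Qed.

Lemma hatL_le_succ t : hatL t <= hatL t.+1.
Proof. exact: (@le_bigmax_ord _ _ _ _ _ xpredT Lest). Qed.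

Lemma Lest0_le_hatL t : L0 <= hatL t.
Proof. exact: (le_bigmax _ (fun s : 'I_t.+1 => Lest s) ord0). Qed.

(** When two successive iterates coincide, the quotient in [Lest] is 0 and both
sides vanish. *)
Lemma Lest_curvature t :
  Lest t.+1 * enorm (x t.+1 - x t) ^+ 2 =
  2 * (f (x t.+1) - f (x t) - dot (gradf (x t)) (x t.+1 - x t)).
Proof.
rewrite /=; have [e0|e_neq0] := eqVneq (enorm (x t.+1 - x t)) 0; last first.
  by rewrite divfK // sqrf_eq0.
have dx0 := enorm_eq0 e0; have /eqP := dx0; rewrite subr_eq0 => /eqP xE.
by rewrite e0 dx0 -(scale0r (x t)) dotZr xE expr0n /=; ring.
Qed.

Lemma local_curvature_eq xstar t :
  local_curvature f gradf x xstar t * enorm (x t - xstar) ^+ 2 =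
  2 * (f (x t) + dot (gradf (x t)) (xstar - x t) - f xstar).
Proof.
rewrite /local_curvature.
have [e0|e_neq0] := eqVneq (enorm (x t - xstar)) 0; last first.
  by rewrite divfK // sqrf_eq0.
have /eqP := enorm_eq0 e0; rewrite subr_eq0 => /eqP xE.
by rewrite e0 xE subrr -(scale0r xstar) dotZr expr0n /=; ring.
Qed.

Lemma segment_starts_growth j : 0 < L0 ->
  (3 / 2) ^+ count starts (index_iota 2 j.+1) * L0 <= hatL j.
Proof.
move=> L0_gt0; elim: j => [|[|j] IH].
- by rewrite expr0 mul1r Lest0_le_hatL.
- by rewrite expr0 mul1r Lest0_le_hatL.
rewrite index_iota_rcons // -cats1 count_cat /= addn0.
have [s|_] := boolP (starts _); last by rewrite addn0 (le_trans IH) ?hatL_le_succ.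
rewrite addn1 exprS -mulrA; apply: le_trans (Lest_le_hatL _).
apply: le_trans (ltW s); rewrite ler_wpM2l //; lra.
Qed.

Hypothesis X_convex : convex_set (X : set (convex_lmodType 'rV[R]_n)).
Hypothesis X_compact : compact X.
Hypothesis gradf_lip : forall y z, X y -> X z ->
  enorm (gradf y - gradf z) <= L * enorm (y - z).
Hypothesis f_lower : forall y z, X y -> X z ->
  - (l / 2) * enorm (y - z) ^+ 2 <= f y - f z - dot (gradf z) (y - z).
Hypothesis x0_in : X (x 0%N).
Hypothesis L0_gt0 : 0 < L0.
Hypothesis L0_le_L : L0 <= L.
Hypothesis x_ACPG : is_ACPG X f gradf L0 x.

Lemma iterate_in t : X (x t).
Proof. by case: t => [//|t]; have [] := x_ACPG (ltn0Sn t). Qed.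

Lemma hatL_gt0 t : 0 < hatL t.
Proof. exact: lt_le_trans L0_gt0 (Lest0_le_hatL t). Qed.

Lemma Lest_le t : Lest t <= L.
Proof.
case: t => [//|t] /=; set e := enorm _.
have [e0|e_neq0] := eqVneq e 0.
  by rewrite e0 expr0n invr0 mulr0; apply: le_trans L0_le_L; apply: ltW.
rewrite ler_pdivrMr; last by rewrite exprn_even_gt0 //= e_neq0.
have := linerr_upper X_convex gradf_lip f_lower (iterate_in t.+1) (iterate_in t).
by rewrite -/e; lra.
Qed.

Lemma nsegments_le k :
  (nsegments f gradf L0 x k)%:Z <= Num.floor (ln (L / L0) / ln (3 / 2)) + 1.
Proof.
rewrite /nsegments PoszD addrC lerD2r floor_ge_int -pmulrn.
have r1 : 1 < 3 / 2 :> R by lra.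
have r0 : 0 < 3 / 2 :> R by lra.
set c := count _ _.
rewrite ler_pdivlMr ?ln_gt0 // (mulr_natl (ln _) c) -lnXn //.
have L_gt0 : 0 < L by apply: lt_le_trans L0_le_L.
rewrite ler_ln ?posrE ?exprn_gt0 ?divr_gt0 // ler_pdivlMr //.
apply: le_trans (segment_starts_growth k L0_gt0) _.
by apply/bigmax_leP; split=> // s _; apply: Lest_le.
Qed.

Lemma prox_step t y : X y ->
  dot (gradf (x t)) (x t.+1 - y) + hatL t / 2 * enorm (x t.+1 - x t) ^+ 2
    + hatL t / 2 * enorm (x t.+1 - y) ^+ 2
  <= hatL t / 2 * enorm (x t - y) ^+ 2.
Proof.
move=> Xy; rewrite (enorm_subC (x t.+1) (x t)).
exact: (@prox_three_points _ _ X X_convex (gradf (x t)) (x t) (x t.+1) y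
  (hatL t) (x_ACPG (ltn0Sn t)) Xy).
Qed.

(** The step tested against the current iterate. *)
Lemma ACPG_descent t :
  f (x t.+1) <= f (x t) - hatL t * enorm (x t.+1 - x t) ^+ 2
    + Lest t.+1 / 2 * enorm (x t.+1 - x t) ^+ 2.
Proof.
have enorm0 : enorm (0 : 'rV[R]_n) = 0.
  by rewrite -(scale0r 0) enormZ normr0 mul0r.
have := prox_step t (iterate_in t); rewrite subrr enorm0 [0 ^+ 2]expr2.
have := Lest_curvature t; move: (Defs.Lest _ _ _ _ _) => Le; lra.
Qed.

(** The step tested against the minimizer. *)
Lemma ACPG_gap xstar t : X xstar ->
  f (x t.+1) - f xstar <=
    Num.max 0 (local_curvature f gradf x xstar t) / 2 * enorm (x t - xstar) ^+ 2
    + hatL t / 2 * (enorm (x t - xstar) ^+ 2 - enorm (x t.+1 - xstar) ^+ 2)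
    + (Lest t.+1 - hatL t) / 2 * enorm (x t.+1 - x t) ^+ 2.
Proof.
move=> Xs; have := prox_step t Xs; have := Lest_curvature t.
have := local_curvature_eq xstar t.
set lt := local_curvature _ _ _ _ _; set lpos := Num.max 0 lt.
have : lt * enorm (x t - xstar) ^+ 2 <= lpos * enorm (x t - xstar) ^+ 2.
  by rewrite ler_wpM2r ?sqr_ge0 // le_max lexx orbT.
rewrite !dotBr; move: (Defs.Lest _ _ _ _ _) => Le; lra.
Qed.

End Iterates.
Theorem theorem2 (R : realType) (n : nat) (X : set 'rV[R]_n)
    (f : 'rV[R]_n -> R) (gradf : 'rV[R]_n -> 'rV[R]_n)
    (L l L0 : R) (xstar : 'rV[R]_n) (x : nat -> 'rV[R]_n) (k : nat)
    (X_convex : convex_set (X : set (convex_lmodType 'rV[R]_n)))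
    (X_compact : compact X)
    (f_C1 : continuously_differentiable_on X f gradf)
    (gradf_lip : forall y z, X y -> X z ->
       enorm (gradf y - gradf z) <= L * enorm (y - z))
    (l_ge0 : 0 <= l) (l_le_L : l <= L)
    (f_lower : forall y z, X y -> X z ->
       - (l / 2) * enorm (y - z) ^+ 2 <= f y - f z - dot (gradf z) (y - z))
    (xstar_min : is_minimizer X f xstar)
    (x0_in : X (x 0%N))
    (L0_gt0 : 0 < L0) (L0_le_L : L0 <= L)
    (x_ACPG : is_ACPG X f gradf L0 x)
    (k_gt0 : (0 < k)%N) :
  let Lhat := hatL f gradf L0 x in
  let g := proj_grad f gradf L0 x in
  let D := diameter X in
  let m := nsegments f gradf L0 x k in
  m%:Z <= Num.floor (ln (L / L0) / ln (3 / 2)) + 1 /\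
  ((2 * m < k)%N ->
   \big[Num.min/enorm (g 1%N) ^+ 2]_(1 <= t < k.+1) enorm (g t) ^+ 2 <=
     48 * Lhat k.-1 ^+ 2 * D ^+ 2 / (k%:R - 2 * m%:R) ^+ 2 +
     12 * Lhat k.-1 * D ^+ 2 *
       (\sum_(0 <= t < k) Num.max 0 (local_curvature f gradf x xstar t))
       / (k%:R - 2 * m%:R) ^+ 2).
Proof.
move=> Lhat g D m; split.
  exact: (nsegments_le X_convex gradf_lip f_lower).
move=> mk; set G := \big[_/_]_(_ <= _ < _) _.
have [Xs xs_le] := xstar_min.
have xX t : X (x t) by apply: iterate_in x_ACPG t.
have sq_dist_rng y z : X y -> X z -> 0 <= enorm (y - z) ^+ 2 <= D ^+ 2.
  move=> Xy Xz; rewrite sqr_ge0 ler_pXn2r ?nnegrE ?enorm_ge0 //.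
    exact: dist_le_diameter.
  exact: le_trans (enorm_ge0 _) (dist_le_diameter X_compact Xy Xz).
have G_ge0 : 0 <= G.
  by apply: (big_ind (fun y => 0 <= y)) => [|u v u0 v0|t _];
     rewrite ?sqr_ge0 // le_min u0.
have G_le t : (0 < t < k)%N -> G <= Lhat t ^+ 2 * enorm (x t.+1 - x t) ^+ 2.
  move=> ht; apply: (@bigmin_inf_seq _ _ _ _ _ t); rewrite ?mem_index_iota //.
    lia.
  by rewrite /g /proj_grad enormZ exprMn real_normK ?num_real // enorm_subC.
have km : 0 < k%:R - 2 * m%:R :> R by rewrite subr_gt0 -natrM ltr_nat.
rewrite -mulrDl ler_pdivlMr ?exprn_gt0 // mulrC.
have Delta_ge0 t : 0 <= f (x t) - f xstar by rewrite subr_ge0; apply: xs_le.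
have descent t : f (x t.+1) - f xstar <= f (x t) - f xstar
    - Lhat t * enorm (x t.+1 - x t) ^+ 2
    + Lest f gradf L0 x t.+1 / 2 * enorm (x t.+1 - x t) ^+ 2.
  have := ACPG_descent X_convex x0_in x_ACPG t.
  by rewrite -/Lhat; move: (Lest _ _ _ _ _) => Le; lra.
apply: le_trans (all_segments_bound (D2 := D ^+ 2) (sqr_ge0 _) G_ge0 Delta_ge0
  (fun t => sq_dist_rng _ _ (xX t) Xs) (fun t => sq_dist_rng _ _ (xX t.+1) (xX t))
  (hatL_gt0 f gradf x L0_gt0) (hatL_le_succ f gradf L0 x) (Lest_le_hatL f gradf L0 x)
  _ descent (fun t => ACPG_gap X_convex x_ACPG t Xs) mk G_le) _.
  by move=> t; rewrite le_max lexx.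
by rewrite -/Lhat; move: (Lhat k.-1) (\sum_(_ <= _ < _) _) => h S; lra.
Qed.
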